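(* Let $G$ be a Lie group with a left invariant, Ad-invariant inner product, and let $\Omega G$ be its based loop group. The curvature of the Levi-Civita connection for the $H^1$ inner product on $\Omega G$ associated to $-\frac{d^2}{d\theta^2}\otimes\mathrm{Id}$ is a pseudodifferential operator of order $-\infty$; that is, for left invariant vector fields $X,Y$, the operator $\Omega(X,Y)$ is a smoothing operator.
   Context: $\mathfrak g$ is the Lie algebra of $G$ with Ad-invariant inner product $(\cdot,\cdot)_{\mathfrak g}$. $\Omega G\subset LG$ has tangent space $T_\gamma\Omega G=\{X\in T_\gamma LG: X(0)=X(2\pi)=0\}$ in some Sobolev topology; using left invariant frames, tangent vectors are identified with $\mathfrak g$-valued functions on $S^1=[0,2\pi]/0\sim2\pi$, and left invariant vector fields on $\Omega G$ with such functions. Let $\Delta=-\frac{d^2}{d\theta^2}\otimes\mathrm{Id}_{\mathfrak g}$, which has no kernel on this space. The $H^1$ inner product is the left invariant metric $\langle X,Y\rangle_1=\int_{S^1}(\Delta X,Y)_{\mathfrak g}\,d\theta$ (up to a normalizing constant). Its Levi-Civita connection on left invariant fields is $\nabla_XY=\frac12\big([X,Y]+\Delta^{-1}[X,\Delta Y]+\Delta^{-1}[Y,\Delta X]\big)$, with pointwise bracket in $\mathfrak g$, and its curvature is $\Omega(X,Y)=[\nabla_X,\nabla_Y]-\nabla_{[X,Y]}$, viewed as an operator on $\mathfrak g$-valued functions on $S^1$. A pseudodifferential operator of order $-\infty$ is a smoothing operator. *)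

(* Defs.v *)
From mathcomp Require Import all_boot all_order all_algebra.
From mathcomp Require Import all_classical all_reals all_analysis.
From mathcomp Require Import ring lra.

Set Implicit Arguments.
Unset Strict Implicit.
Unset Printing Implicit Defensive.

Import Order.TTheory GRing.Theory Num.Theory.
Import numFieldNormedType.Exports.

Local Open Scope classical_set_scope.
Local Open Scope ring_scope.

(* The finite-dimensional Lie algebra of the Lie group, written in a basis as
   R^n with an arbitrary bracket; the inner product is arbitrary too (the basis
   need not be orthonormal). *)
Section Algebra.
Context {R : realType} {n : nat}.
Notation g := 'rV[R]_n.

Record lie_bracket (br : g -> g -> g) : Prop := LieBracket {
  lie_linearl : forall z a x y, br (a *: x + y) z = a *: br x z + br y z ;
  lie_linearr : forall z a x y, br z (a *: x + y) = a *: br z x + br z y ;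
  lie_alt : forall x, br x x = 0 ;
  lie_jacobi : forall x y z,
    br x (br y z) + br y (br z x) + br z (br x y) = 0 }.

Record inner_product (ip : g -> g -> R) : Prop := InnerProduct {
  ip_linearl : forall z a x y, ip (a *: x + y) z = a * ip x z + ip y z ;
  ip_sym : forall x y, ip x y = ip y x ;
  ip_pos : forall x, x != 0 -> 0 < ip x x }.

(* The infinitesimal form of Ad-invariance: differentiate
   ip (Ad_{exp tx} y) (Ad_{exp tx} z) = ip y z at t = 0. *)
Definition ad_invariant (br : g -> g -> g) (ip : g -> g -> R) :=
  forall x y z, ip (br x y) z + ip y (br x z) = 0.

End Algebra.

Section Loops.
Context {R : realType} {n : nat}.
Notation g := 'rV[R]_n.
Implicit Types X Y Z f u : R -> g.

(* A g-valued function on S^1 = [0, 2 pi] / 0 ~ 2 pi is represented by its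
   2 pi-periodic lift to the line. *)
Definition smooth_loop X :=
  (forall k t, derivable (derive1n k X) t 1) /\ (forall t, X (t + 2 * pi) = X t).

Definition based_loop X := smooth_loop X /\ X 0 = 0.

Definition lap X : R -> g := fun t => - derive1n 2 X t.

(* The Dirichlet problem on [0, 2 pi]. Since f is defined on the whole line,
   the equation is imposed there too: this determines u outside [0, 2 pi]
   without constraining it inside. The solution u is periodic only if f has
   mean zero. *)
Definition dirichlet f u :=
  [/\ forall t, derivable u t 1 /\ derivable (derive1 u) t 1,
      lap u = f, u 0 = 0 & u (2 * pi) = 0].

Definition invlap f : R -> g := xget 0 [set u | dirichlet f u].

Variables (br : g -> g -> g) (ip : g -> g -> R).

Definition lbr X Y : R -> g := fun t => br (X t) (Y t).

Definition H1 X Y : R :=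
  \int[lebesgue_measure]_(t in `[0, 2 * pi]) ip (lap X t) (Y t).

Definition nabla X Y : R -> g :=
  2^-1 *: (lbr X Y + invlap (lbr X (lap Y)) + invlap (lbr Y (lap X))).

Definition curvature X Y Z : R -> g :=
  nabla X (nabla Y Z) - nabla Y (nabla X Z) - nabla (lbr X Y) Z.

(* H1 is left invariant, so it is constant on pairs of left invariant fields
   and the derivative term of metric compatibility vanishes. *)
Record levi_civita (D : (R -> g) -> (R -> g) -> R -> g) : Prop := LeviCivita {
  lc_closed : forall X Y, based_loop X -> based_loop Y -> based_loop (D X Y) ;
  lc_torsion_free : forall X Y, based_loop X -> based_loop Y ->
    D X Y - D Y X = lbr X Y ;
  lc_metric : forall X Y Z, based_loop X -> based_loop Y -> based_loop Z ->
    H1 (D X Y) Z + H1 Y (D X Z) = 0 }.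

End Loops.

Section Smoothing.
Context {R : realType}.

Fixpoint Ck {V : normedModType R} (k : nat) (F : R * R -> V) : Prop :=
  continuous F /\
  if k is k'.+1 then
    [/\ forall p, derivable F p (1, 0) /\ derivable F p (0, 1),
        Ck k' (fun p => 'D_(1, 0) F p) & Ck k' (fun p => 'D_(0, 1) F p)]
  else True.

(* A smooth kernel on S^1 x S^1 with values in End(g); matrices act on row
   vectors from the right. *)
Definition smooth_kernel n (K : R * R -> 'M[R]_n) :=
  (forall k, Ck k K) /\
  (forall s t, K (s + 2 * pi, t) = K (s, t) /\ K (s, t + 2 * pi) = K (s, t)).

(* A pseudodifferential operator of order -oo on g-valued functions on S^1 is
   an integral operator with smooth kernel. *)
Definition smoothing n (T : (R -> 'rV[R]_n) -> R -> 'rV[R]_n) :=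
  exists K : R * R -> 'M[R]_n, smooth_kernel K /\
    forall Z, smooth_loop Z -> forall s,
      T Z s = \row_i \int[lebesgue_measure]_(t in `[0, 2 * pi])
                        (Z t *m K (s, t)) 0 i.

End Smoothing.

(* Well-posedness of the Dirichlet problem (so that invlap inverts lap), and
   nabla is the Levi-Civita connection of H1. *)
Module H1Connection.

Section Calculus.
Context {R : realType} {n : nat}.
Notation g := 'rV[R]_n.
Implicit Types X Y f u : R -> g.

Let smooth X := forall k t, derivable (derive1n k X) t 1.

Lemma is_derive_rV X (t : R) l :
  is_derive t 1 X l <-> forall i, is_derive t 1 (fun s => X s 0 i) (l 0 i).
Proof.
split=> [Xl i|Xl].
  have /derivable_mxP dX : derivable X t 1 by exact: ex_derive.
  apply: DeriveDef; first exact: dX.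
  by rewrite -(@derive_val _ _ _ _ _ _ _ Xl) derive_mx ?mxE//; exact: ex_derive.
have dX : derivable X t 1.
  by apply/derivable_mxP => i j; rewrite ord1; exact: ex_derive.
apply: DeriveDef => //; rewrite derive_mx//; apply/rowP => i; rewrite mxE.
exact: derive_val.
Qed.

Definition deriv (X dX : R -> g) := forall t : R, is_derive t 1 X (dX t).

Lemma derivE X dX : deriv X dX -> derive1 X = dX.
Proof. by move=> h; apply/funext => t; rewrite derive1E; apply: derive_val. Qed.

Lemma deriv_ex X : (forall t, derivable X t 1) -> deriv X (derive1 X).
Proof. by move=> h t; rewrite derive1E; apply/derivableP/h. Qed.

Lemma derivD X dX Y dY : deriv X dX -> deriv Y dY -> deriv (X + Y) (dX + dY).
Proof. by move=> hX hY t; apply: is_deriveD. Qed.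

Lemma derivN X dX : deriv X dX -> deriv (- X) (- dX).
Proof. by move=> hX t; apply: is_deriveN. Qed.

Lemma derivB X dX Y dY : deriv X dX -> deriv Y dY -> deriv (X - Y) (dX - dY).
Proof. by move=> hX hY; apply: derivD => //; exact: derivN. Qed.

Lemma derivZ (a : R) X dX : deriv X dX -> deriv (a *: X) (a *: dX).
Proof. by move=> hX t; apply: is_deriveZ. Qed.

Lemma deriv_lin (c : g) : deriv (fun t => t *: c) (fun=> c).
Proof.
move=> t; apply/is_derive_rV => i.
have -> : (fun s : R => (s *: c) 0 i) = c 0 i \*: id.
  by apply/funext => s; rewrite mxE mulrC.
by apply: is_derive_eq; rewrite -[RHS]mulr1.
Qed.

Lemma deriv_continuous X dX : deriv X dX -> continuous X.
Proof.
by move=> hX t; apply/differentiable_continuous/derivable1_diffP; exact: ex_derive.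
Qed.

Lemma deriv0_cst X : deriv X 0 -> forall s t, X s = X t.
Proof.
move=> hX s t; apply/rowP => i.
apply: (@is_derive_0_is_cst _ (fun s => X s 0 i)) => x.
by have /is_derive_rV/(_ i) := hX x; rewrite mxE.
Qed.

Lemma deriv_shift X dX (p : R) : deriv X dX ->
  deriv (fun t => X (t + p)) (fun t => dX (t + p)).
Proof.
move=> hX t; apply/is_derive_rV => i.
have h1 := (is_derive_rV _ _ _).1 (hX (t + p)) i.
have h2 : is_derive t (1:R) (fun s : R => s + p) 1.
  have -> : (fun s : R => s + p) = id + cst p by [].
  by apply: is_derive_eq; rewrite addr0.
have := @is_derive1_comp _ (fun s => X s 0 i) (fun s => s + p) t _ _ h1 h2.
by rewrite mulr1.
Qed.

Lemma smoothS X : smooth X <-> exists2 dX, deriv X dX & smooth dX.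
Proof.
split=> [sX|[dX hX sdX]].
  exists (derive1 X); first exact/deriv_ex/(sX 0).
  by move=> k; rewrite /derive1n -iterSr; exact: (sX k.+1).
case=> [|k] t; first by have := hX t => ?; exact: ex_derive.
by rewrite /derive1n iterSr (derivE hX); exact: sdX.
Qed.

Fixpoint Dk k X : Prop :=
  if k is k'.+1 then exists2 dX, deriv X dX & Dk k' dX else True.

Lemma smoothDk X : smooth X <-> forall k, Dk k X.
Proof.
split=> [+ k|DX k t].
  elim: k X => [//|k IH] X /smoothS[dX hX /IH h]; by exists dX.
elim: k X DX => [|k IH] X DX.
  by have [dX hX _] := DX 1; have := hX t => ?; exact: ex_derive.
have [dX hX _] := DX 1; rewrite /derive1n iterSr (derivE hX); apply: IH => j.
by have [dX' /derivE + ] := DX j.+1; rewrite (derivE hX) => ->.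
Qed.

Lemma DkD k X Y : Dk k X -> Dk k Y -> Dk k (X + Y).
Proof.
elim: k X Y => [//|k IH] X Y [dX hX DX] [dY hY DY].
by exists (dX + dY); [exact: derivD|exact: IH].
Qed.

Lemma DkW k X : Dk k.+1 X -> Dk k X.
Proof.
elim: k X => [//|k IH] X [dX hX DX]; exists dX => //; exact: IH.
Qed.

Lemma smoothD X Y : smooth X -> smooth Y -> smooth (X + Y).
Proof.
move=> /smoothDk DX /smoothDk DY; apply/smoothDk => k; exact: DkD.
Qed.

Lemma smoothZ (a : R) X : smooth X -> smooth (a *: X).
Proof.
move=> /smoothDk DX; apply/smoothDk => k; move: {DX}(DX k).
elim: k X => [//|k IH] X [dX hX DX].
by exists (a *: dX); [exact: derivZ|exact: IH].
Qed.

Lemma smoothN X : smooth X -> smooth (- X).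
Proof. by move=> sX; rewrite -scaleN1r; exact: smoothZ. Qed.

Lemma smooth_continuous X : smooth X -> continuous X.
Proof. by move=> /smoothS[dX /deriv_continuous]. Qed.

Section Bilinear.
Variable b : g -> g -> R.
Hypothesis bl : forall z a x y, b (a *: x + y) z = a * b x z + b y z.
Hypothesis br : forall z a x y, b z (a *: x + y) = a * b z x + b z y.

Lemma bilE x y :
  b x y = \sum_i \sum_j x 0 i * y 0 j * b (delta_mx 0 i) (delta_mx 0 j).
Proof.
have b0l z : b 0 z = 0.
  have := bl z 1 0 0; rewrite scale1r addr0 mul1r => /eqP.
  by rewrite -subr_eq0 opprD addNKr oppr_eq0 => /eqP.
have b0r z : b z 0 = 0.
  have := br z 1 0 0; rewrite scale1r addr0 mul1r => /eqP.
  by rewrite -subr_eq0 opprD addNKr oppr_eq0 => /eqP.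
have bDl z : {morph b^~ z : x y / x + y}.
  by move=> u v; rewrite -[u]scale1r bl mul1r scale1r.
have bDr z : {morph b z : x y / x + y}.
  by move=> u v; rewrite -[u]scale1r br mul1r scale1r.
rewrite {1}(row_sum_delta x) (big_morph _ (bDl y) (b0l y)).
apply: eq_bigr => i _.
rewrite -[X in b X _]addr0 bl b0l addr0.
rewrite {1}(row_sum_delta y) (big_morph _ (bDr _) (b0r _)) big_distrr/=.
apply: eq_bigr => j _.
by rewrite -[X in b _ X]addr0 br b0r addr0 mulrA.
Qed.

Lemma is_derive_bil X Y (t : R) dX dY : is_derive t 1 X dX -> is_derive t 1 Y dY ->
  is_derive t 1 (fun s => b (X s) (Y s)) (b dX (Y t) + b (X t) dY).
Proof.
move=> /is_derive_rV hX /is_derive_rV hY.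
have -> : (fun s => b (X s) (Y s)) = \sum_i \sum_j
    (b (delta_mx 0 i) (delta_mx 0 j) \*: ((fun s => X s 0 i) * (fun s => Y s 0 j))).
  apply/funext => s; rewrite bilE fct_sumE; apply: eq_bigr => i _.
  by rewrite fct_sumE; apply: eq_bigr => j _; rewrite mulrC.
have -> : b dX (Y t) + b (X t) dY = \sum_i \sum_j
    b (delta_mx 0 i) (delta_mx 0 j) * (X t 0 i * dY 0 j + Y t 0 j * dX 0 i).
  rewrite (bilE dX) (bilE (X t)) -big_split/=; apply: eq_bigr => i _.
  by rewrite -big_split/=; apply: eq_bigr => j _; ring.
apply: is_derive_sum => i; apply: is_derive_sum => j.
by apply: is_deriveZ; exact: is_deriveM.
Qed.

End Bilinear.

Lemma continuous_integrable (f : R -> R) (a b : R) : continuous f ->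
  (@lebesgue_measure R).-integrable `[a, b] (EFin \o f).
Proof.
move=> cf; apply: continuous_compact_integrable; first exact: segment_compact.
by apply: continuous_subspaceT => x; exact: cf.
Qed.

Lemma antiderivative (f : R -> R) : continuous f ->
  exists2 F : R -> R, F 0 = 0 & forall t : R, is_derive t 1 F (f t).
Proof.
move=> cf.
pose I (a t : R) := \int[lebesgue_measure]_(x in `[a, t]) f x.
pose G a t := I a t - I a 0.
have IS a b t : a <= b -> b <= t -> I a t - I a b = I b t.
  move=> ab bt; rewrite /I (@Rintegral_itvB _ f (BLeft a) (BRight t) b)//.
    rewrite Rintegral_itv_obnd_cbnd//.
    apply: integrableS (continuous_integrable b t cf) => //.
    by apply: subset_itvr; rewrite bnd_simp.
  exact: continuous_integrable.
have GS a b t : a <= b -> b <= t -> b <= 0 -> G a t = G b t.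
  move=> ab bt b0; rewrite /G -(IS a b t)// -(IS a b 0)//; ring.
exists (fun t => G (- `|t| - 1) t); first by rewrite /G subrr.
move=> t; set a := - `|t| - 2.
have dG : is_derive t (1 : R) (G a) (f t).
  have at_ : a < t by rewrite /a; have := ler_norm (- t); rewrite normrN; lra.
  have [dI I't] := @continuous_FTC1_closed _ f a t (t + 1) ltac:(lra)
    (continuous_integrable _ _ cf) at_ (cf t).
  have -> : G a = I a - cst (I a 0) by [].
  rewrite -[f t]subr0; apply: is_deriveB.
  by apply: DeriveDef; [exact: dI|rewrite -derive1E; exact: I't].
apply: near_eq_is_derive dG; near=> s.
have ts : `|t - s| < 1 by near: s; exact: cvgr_dist_lt.
apply: GS; first 1 last.
- by have := ler_norm (- s); rewrite normrN; lra.
- by have := normr_ge0 s; lra.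
have := ler_normB t (t - s); rewrite /a opprB addrCA subrr addr0; lra.
Unshelve. all: by end_near. Qed.

Lemma antideriv f : continuous f -> exists2 F, F 0 = 0 & deriv F f.
Proof.
move=> cf.
have h i : {F : R -> R | F 0 = 0 & forall t : R, is_derive t 1 F (f t 0 i)}.
  apply/cid2; apply: (@antiderivative (fun t => f t 0 i)) => t.
  apply: (@continuous_comp _ _ _ f (fun x : g => x 0 i)); first exact: cf.
  exact: coord_continuous.
exists (fun t => \row_i s2val (h i) t).
  by apply/rowP => i; rewrite !mxE; exact: (s2valP (h i)).
move=> t; apply/is_derive_rV => i.
have -> : (fun s => (\row_j s2val (h j) s) 0 i) = s2val (h i).
  by apply/funext => s; rewrite mxE.
exact: (s2valP' (h i)).
Qed.

Lemma twopi_gt0 : 0 < 2 * pi :> R.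
Proof. by rewrite mulr_gt0// pi_gt0. Qed.

Lemma dirichlet_deriv f u : dirichlet f u <->
  [/\ exists2 v, deriv u v & deriv v (- f), u 0 = 0 & u (2 * pi) = 0].
Proof.
split=> [[du luf u0 u1]|[[v hv hf] u0 u1]]; split=> //.
  exists (derive1 u); first by apply: deriv_ex => t; have [] := du t.
  have -> : - f = derive1 (derive1 u).
    by rewrite -luf; apply/funext => t; rewrite /lap/= fctE opprK.
  by apply: deriv_ex => t; have [] := du t.
- move=> t; rewrite (derivE hv); split.
    by have := hv t => ?; exact: ex_derive.
  by have := hf t => ?; exact: ex_derive.
- apply/funext => t.
  by rewrite /lap /derive1n/= (derivE hv) (derivE hf) fctE opprK.
Qed.

Lemma dirichlet_unique f u v : dirichlet f u -> dirichlet f v -> u = v.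
Proof.
move=> /dirichlet_deriv[[u' hu hu'] u0 u1] /dirichlet_deriv[[v' hv hv'] v0 v1].
have /deriv0_cst h2 : deriv (u' - v') 0.
  by rewrite -(subrr (- f)); exact: derivB.
have /deriv0_cst h1 : deriv (u - v - (fun t => t *: (u' - v') 0)) 0.
  have -> : 0 = u' - v' - (fun=> (u' - v') 0) :> (R -> g).
    apply/funext => t; have e : (u' - v') t - (u' - v') 0 = 0.
      by rewrite (h2 t 0) subrr.
    exact: esym e.
  by apply: derivB; [exact: derivB|exact: deriv_lin].
have d t : u t - v t = t *: (u' - v') 0.
  have e : u t - v t - t *: (u' - v') 0 = u 0 - v 0 - 0 *: (u' - v') 0 :=
    h1 t 0.
  by apply/eqP; rewrite -subr_eq0 e u0 v0 scale0r !subr0.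
have c0 : (u' - v') 0 = 0.
  have := d (2 * pi); rewrite u1 v1 subrr => /esym/eqP.
  by rewrite scaler_eq0 gt_eqF ?twopi_gt0//= => /eqP.
by apply/funext => t; apply/eqP; rewrite -subr_eq0 d c0 scaler0.
Qed.

Lemma dirichlet_exists f : continuous f -> exists u, dirichlet f u.
Proof.
move=> cf; have [F F0 hF] := antideriv cf.
have [H H0 hH] := antideriv (deriv_continuous hF).
pose c := (2 * pi)^-1 *: H (2 * pi).
exists ((fun t => t *: c) - H); apply/dirichlet_deriv; split.
- exists ((fun=> c) - F); first by apply: derivB => //; exact: deriv_lin.
  rewrite -[X in deriv _ X]sub0r; apply: derivB => // t; exact: is_derive_cst.
- by change (0 *: c - H 0 = 0); rewrite H0 scale0r subr0.
- change (2 * pi *: c - H (2 * pi) = 0).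
  by rewrite scalerA divff ?scale1r ?subrr// gt_eqF// twopi_gt0.
Qed.

Lemma invlapP f : continuous f -> dirichlet f (invlap f).
Proof.
by move=> cf; have [u hu] := dirichlet_exists cf; rewrite /invlap; case: xgetP => // /(_ u).
Qed.

Lemma lapK X : based_loop X -> invlap (lap X) = X.
Proof.
move=> [[sX pX] X0].
have dX : dirichlet (lap X) X.
  split=> //; first by move=> t; split; [exact: (sX 0)|exact: (sX 1)].
  by rewrite -X0 -(pX 0) add0r.
by apply: xget_unique => // u hu; exact: dirichlet_unique hu dX.
Qed.

Lemma integralD_cont (a b : R) (f h : R -> R) : continuous f -> continuous h ->
  \int[lebesgue_measure]_(t in `[a, b]) (f t + h t) =
  \int[lebesgue_measure]_(t in `[a, b]) f t +
  \int[lebesgue_measure]_(t in `[a, b]) h t.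
Proof. by move=> cf ch; rewrite RintegralD//; exact: continuous_integrable. Qed.

Lemma integral_derivative (a b : R) (q q' : R -> R) : a < b ->
  (forall t, is_derive t (1 : R) q (q' t)) -> continuous q' ->
  \int[lebesgue_measure]_(t in `[a, b]) q' t = q b - q a.
Proof.
move=> ab dq cq'.
have cq : continuous q.
  move=> t; apply/differentiable_continuous/derivable1_diffP.
  by have := dq t => ?; exact: ex_derive.
rewrite /Rintegral (@continuous_FTC2 _ q' q)//.
- by apply: continuous_subspaceT => x; exact: cq'.
- split; first by move=> t _; have := dq t => ?; exact: ex_derive.
    by apply: cvg_at_right_filter; exact: cq.
  by apply: cvg_at_left_filter; exact: cq.
- by move=> t _; rewrite derive1E; apply: derive_val.
Qed.

End Calculus.

Section LeviCivita.
Context {R : realType} {n : nat}.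
Notation g := 'rV[R]_n.
Implicit Types X Y f u : R -> g.
Local Notation smooth X := (forall k t, derivable (derive1n k X) t 1).

Variables (br : g -> g -> g) (ip : g -> g -> R).
Hypotheses (hbr : lie_bracket br) (hip : inner_product ip).
Hypothesis (hinv : ad_invariant br ip).

Let brDl x y z : br (x + y) z = br x z + br y z.
Proof. by rewrite -[x]scale1r (lie_linearl hbr) !scale1r. Qed.

Let brDr x y z : br z (x + y) = br z x + br z y.
Proof. by rewrite -[x]scale1r (lie_linearr hbr) !scale1r. Qed.

Let brC x y : br x y = - br y x.
Proof.
apply/eqP; rewrite -subr_eq0 opprK; apply/eqP.
have := lie_alt hbr (x + y).
by rewrite brDl !brDr !(lie_alt hbr) add0r addr0.
Qed.

Let br0l x : br 0 x = 0.
Proof.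
by have := brDl 0 0 x; rewrite addr0 => /eqP; rewrite -subr_eq0 opprD addNKr oppr_eq0 => /eqP.
Qed.

Let brNl x y : br (- x) y = - br x y.
Proof. by apply/eqP; rewrite -subr_eq0 opprK -brDl addNr br0l. Qed.

Let brNr x y : br x (- y) = - br x y.
Proof. by rewrite brC brNl -brC. Qed.

Let ipDl x y z : ip (x + y) z = ip x z + ip y z.
Proof. by rewrite -[x]scale1r (ip_linearl hip) mul1r scale1r. Qed.

Let ip0l z : ip 0 z = 0.
Proof.
by have := ipDl 0 0 z; rewrite addr0 => /eqP; rewrite -subr_eq0 opprD addNKr oppr_eq0 => /eqP.
Qed.

Let ipZl a x z : ip (a *: x) z = a * ip x z.
Proof. by rewrite -[a *: x]addr0 (ip_linearl hip) ip0l addr0. Qed.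

Let ipNl x z : ip (- x) z = - ip x z.
Proof. by rewrite -scaleN1r ipZl mulN1r. Qed.

Let ip_linearr z a x y : ip z (a *: x + y) = a * ip z x + ip z y.
Proof. by rewrite !(ip_sym hip z) (ip_linearl hip). Qed.

Let ipNr x z : ip x (- z) = - ip x z.
Proof. by rewrite !(ip_sym hip x) ipNl. Qed.

Lemma deriv_lbr X dX Y dY : deriv X dX -> deriv Y dY ->
  deriv (lbr br X Y) (lbr br dX Y + lbr br X dY).
Proof.
move=> hX hY t; apply/is_derive_rV => i; rewrite mxE.
apply: (@is_derive_bil _ _ (fun x y => br x y 0 i)) => //.
  by move=> z a x y; rewrite (lie_linearl hbr) !mxE.
by move=> z a x y; rewrite (lie_linearr hbr) !mxE.
Qed.

Lemma smooth_lbr X Y : smooth X -> smooth Y -> smooth (lbr br X Y).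
Proof.
move=> /smoothDk DX /smoothDk DY; apply/smoothDk => k.
move: {DX DY}(DX k) (DY k); elim: k X Y => [//|k IH] X Y DX DY.
have [dX hX DdX] := DX; have [dY hY DdY] := DY.
exists (lbr br dX Y + lbr br X dY); first exact: deriv_lbr.
by apply: DkD; apply: IH => //; exact: DkW.
Qed.

Lemma smooth_loop_lbr X Y : smooth_loop X -> smooth_loop Y ->
  smooth_loop (lbr br X Y).
Proof.
move=> [sX pX] [sY pY]; split; first exact: (smooth_lbr sX sY).
by move=> t; rewrite /lbr pX pY.
Qed.

Lemma smooth_loop_deriv X : smooth_loop X ->
  exists2 dX, deriv X dX & smooth_loop dX.
Proof.
move=> [/smoothS[dX hX sdX] pX]; exists dX => //; split=> // t.
have := deriv_shift (2 * pi) hX.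
have -> : (fun t => X (t + 2 * pi)) = X by apply/funext => s; rewrite pX.
by move=> /derivE; rewrite (derivE hX) => /(congr1 (fun f => f t)).
Qed.

Lemma smooth_loop_deriv2 X : smooth_loop X -> exists X1 X2,
  [/\ deriv X X1, deriv X1 X2, smooth_loop X1, smooth_loop X2 & lap X = - X2].
Proof.
move=> /smooth_loop_deriv[X1 h1 l1]; have [X2 h2 l2] := smooth_loop_deriv l1.
exists X1, X2; split=> //.
by apply/funext => t; rewrite /lap /derive1n/= (derivE h1) (derivE h2).
Qed.

Lemma smooth_loopD X Y : smooth_loop X -> smooth_loop Y -> smooth_loop (X + Y).
Proof.
move=> [sX pX] [sY pY]; split; first exact: (smoothD sX sY).
by move=> t; change (X (t + 2 * pi) + Y (t + 2 * pi) = X t + Y t); rewrite pX pY.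
Qed.

Lemma smooth_loopZ (a : R) X : smooth_loop X -> smooth_loop (a *: X).
Proof.
move=> [sX pX]; split; first exact: (@smoothZ _ _ a X sX).
by move=> t; change (a *: X (t + 2 * pi) = a *: X t); rewrite pX.
Qed.

Lemma smooth_loop_lap X : smooth_loop X -> smooth_loop (lap X).
Proof.
move=> /smooth_loop_deriv2[X1 [X2 [_ _ _ l2 ->]]].
by rewrite -scaleN1r; exact: smooth_loopZ.
Qed.

Lemma lapD X Y : smooth_loop X -> smooth_loop Y -> lap (X + Y) = lap X + lap Y.
Proof.
move=> /smooth_loop_deriv2[X1 [X2 [hX1 hX2 _ _ ->]]].
move=> /smooth_loop_deriv2[Y1 [Y2 [hY1 hY2 _ _ ->]]].
rewrite -opprD; apply/funext => t; rewrite /lap /derive1n/=.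
by rewrite (derivE (derivD hX1 hY1)) (derivE (derivD hX2 hY2)).
Qed.

Lemma lapZ (a : R) X : smooth_loop X -> lap (a *: X) = a *: lap X.
Proof.
move=> /smooth_loop_deriv2[X1 [X2 [hX1 hX2 _ _ ->]]].
rewrite scalerN; apply/funext => t; rewrite /lap /derive1n/=.
by rewrite (derivE (derivZ a hX1)) (derivE (derivZ a hX2)).
Qed.

(* The two Dirichlet problems in nabla have opposite means, so that the sum
   of their solutions is again a smooth loop. *)
Lemma nablaE X Y : smooth_loop X -> smooth_loop Y -> exists U,
  [/\ smooth_loop U, U 0 = 0, lap U = lbr br X (lap Y) + lbr br Y (lap X)
    & nabla br X Y = 2^-1 *: (lbr br X Y + U)].
Proof.
move=> lX lY.
have := smooth_loop_lbr lX (smooth_loop_lap lY).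
have := smooth_loop_lbr lY (smooth_loop_lap lX).
rewrite /nabla; move EB : (lbr br Y _) => B lB; move EA : (lbr br X _) => A lA.
have /invlapP/dirichlet_deriv[[u hu hu'] u0 u1] := smooth_continuous lA.1.
have /invlapP/dirichlet_deriv[[v hv hv'] v0 v1] := smooth_continuous lB.1.
have h1 := derivD hu hv; have h2 := derivD hu' hv'.
have U0 : invlap A 0 + invlap B 0 = 0 by rewrite u0 v0 addr0.
exists (invlap A + invlap B); split; last by rewrite addrA.
- split.
    apply/smoothS; exists (u + v) => //; apply/smoothS; exists (- A + - B) => //.
    by rewrite -opprD; apply: smoothN; exact: smoothD lA.1 lB.1.
  have [X1 [X2 [hX1 hX2 lX1 lX2 lapX]]] := smooth_loop_deriv2 lX.
  have [Y1 [Y2 [hY1 hY2 lY1 lY2 lapY]]] := smooth_loop_deriv2 lY.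
  pose P := lbr br X Y1 - lbr br X1 Y.
  have hP : deriv P (- A - B).
    have -> : - A - B =
        lbr br X1 Y1 + lbr br X Y2 - (lbr br X2 Y + lbr br X1 Y1).
      apply/funext => t; rewrite -EA -EB lapX lapY.
      change (- br (X t) (- Y2 t) - br (Y t) (- X2 t) =
        br (X1 t) (Y1 t) + br (X t) (Y2 t)
        - (br (X2 t) (Y t) + br (X1 t) (Y1 t))).
      rewrite !brNr !opprK (brC (Y t)).
      by rewrite [in RHS](addrC (br (X1 t) (Y1 t))) opprD addrACA subrr addr0.
    by apply: derivB; exact: deriv_lbr.
  have uvP : forall s t, (u + v - P) s = (u + v - P) t.
    by apply: deriv0_cst; rewrite -(subrr (- A - B)); exact: derivB.
  have pP t : P (t + 2 * pi) = P t.
    change (br (X (t + 2 * pi)) (Y1 (t + 2 * pi)) -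
       br (X1 (t + 2 * pi)) (Y (t + 2 * pi)) =
       br (X t) (Y1 t) - br (X1 t) (Y t)).
    by rewrite lX.2 lY.2 lX1.2 lY1.2.
  have {v1}U1 : invlap A (2 * pi) + invlap B (2 * pi) = 0 by rewrite u1 v1 addr0.
  move EU : (invlap A + invlap B) => U in h1 *.
  have /deriv0_cst cU : deriv ((fun t => U (t + 2 * pi)) - U) 0.
    have -> : 0 = (fun t => (u + v) (t + 2 * pi)) - (u + v).
      apply/funext => t.
      change (0 = (u + v) (t + 2 * pi) - (u + v) t).
      have := uvP (t + 2 * pi) t.
      change ((u + v) (t + 2 * pi) - P (t + 2 * pi) = (u + v) t - P t -> 
        0 = (u + v) (t + 2 * pi) - (u + v) t).
      by rewrite pP => /addIr ->; rewrite subrr.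
    by apply: derivB => //; exact: deriv_shift.
  have U0' : U 0 = 0 by rewrite -EU; exact: U0.
  have {}U1 : U (0 + 2 * pi) = 0 by rewrite add0r -EU; exact: U1.
  move=> t; apply/eqP; rewrite -subr_eq0; apply/eqP; apply: (etrans (cU t 0)).
  exact: etrans (f_equal2 (fun a b => a - b) U1 U0') (subrr 0).
- exact: U0.
- apply/funext => t; rewrite /lap /derive1n/= (derivE h1) (derivE h2).
  by change (- (- A t - B t) = A t + B t); rewrite opprD !opprK.
Qed.

Lemma is_derive_ip X dX Y dY (t : R) : deriv X dX -> deriv Y dY ->
  is_derive t (1 : R) (fun s => ip (X s) (Y s)) (ip (dX t) (Y t) + ip (X t) (dY t)).
Proof. by move=> hX hY; apply: is_derive_bil => //; exact: ip_linearl. Qed.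

Lemma continuous_ip X Y : smooth X -> smooth Y ->
  continuous (fun t => ip (X t) (Y t)).
Proof.
move=> /smoothS[dX hX _] /smoothS[dY hY _] t.
apply/differentiable_continuous/derivable1_diffP.
by have := is_derive_ip t hX hY => ?; exact: ex_derive.
Qed.

Lemma H1_sym X Y : smooth_loop X -> smooth_loop Y -> H1 ip X Y = H1 ip Y X.
Proof.
move=> lX lY.
have [X1 [X2 [hX1 hX2 lX1 lX2 lapX]]] := smooth_loop_deriv2 lX.
have [Y1 [Y2 [hY1 hY2 lY1 lY2 lapY]]] := smooth_loop_deriv2 lY.
pose q t := ip (X t) (Y1 t) - ip (X1 t) (Y t).
pose q' t := ip (lap X t) (Y t) + ip (- lap Y t) (X t).
have dq (t : R) : is_derive t (1 : R) q (q' t).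
  have := is_deriveB (is_derive_ip t hX1 hY2) (is_derive_ip t hX2 hY1).
  congr (is_derive t 1 _ _); rewrite /q' lapX lapY.
  change (ip (X1 t) (Y1 t) + ip (X t) (Y2 t) - (ip (X2 t) (Y t) + ip (X1 t) (Y1 t))
    = ip (- X2 t) (Y t) + ip (- - Y2 t) (X t)).
  by rewrite opprK ipNl (ip_sym hip (Y2 t)); ring.
have c1 : continuous (fun t => ip (lap X t) (Y t)).
  exact: continuous_ip (smooth_loop_lap lX).1 lY.1.
have c2 : continuous (fun t => ip (- lap Y t) (X t)).
  by apply: continuous_ip lX.1; apply: smoothN (smooth_loop_lap lY).1.
have cq' : continuous q' by move=> t; apply: cvgD; [exact: c1|exact: c2].
have := integral_derivative twopi_gt0 dq cq'.
rewrite /q -[2 * pi]add0r !(lX.2, lX1.2, lY.2, lY1.2) subrr /q' add0r.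
rewrite integralD_cont//.
rewrite (_ : \int[_]_(_ in _) ip (- _) _ = - H1 ip Y X).
  by move=> /eqP; rewrite subr_eq0 => /eqP.
rewrite -mulN1r /H1 -RintegralZl//; last first.
  exact/continuous_integrable/continuous_ip/lX.1/(smooth_loop_lap lY).1.
by under eq_Rintegral do rewrite ipNl -mulN1r.
Qed.

Let half_alt (w w' u v : R -> g) : w' = - w ->
  2^-1 *: (w + u + v) - 2^-1 *: (w' + v + u) = w.
Proof.
move=> ->; rewrite -scalerBr -(addrA w) -(addrA (- w)) (addrC v u) opprD opprK.
rewrite addrACA subrr addr0 (_ : w + w = 2 *: w); last by rewrite scaler_nat mulr2n.
by rewrite scalerA mulVf ?scale1r.
Qed.

Let koszul x dx y dy z dz :
  ip dz (br x y) + ip (br x dy + br y dx) z +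
  (ip dy (br x z) + ip (br x dz + br z dx) y) = 0.
Proof.
rewrite !ipDl (brC y) (brC z) !ipNl.
have := hinv x dz y; have := hinv x dy z; have := hinv dx y z.
rewrite (ip_sym hip y); lra.
Qed.

Theorem nabla_levi_civita : levi_civita br ip (nabla br).
Proof.
have lN X Y : smooth_loop X -> smooth_loop Y -> smooth_loop (nabla br X Y).
  move=> lX lY; have [U [lU _ _ ->]] := nablaE lX lY.
  exact/smooth_loopZ/smooth_loopD/lU/smooth_loop_lbr.
have lapN X Y : smooth_loop X -> smooth_loop Y -> lap (nabla br X Y) =
    2^-1 *: (lap (lbr br X Y) + (lbr br X (lap Y) + lbr br Y (lap X))).
  move=> lX lY; have [U [lU _ <- ->]] := nablaE lX lY.
  have lXY := smooth_loop_lbr lX lY.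
  by rewrite lapZ ?lapD//; exact: smooth_loopD.
split.
- move=> X Y [lX X0] [lY Y0]; split; first exact: lN.
  have [U [_ U0 _ ->]] := nablaE lX lY.
  change (2^-1 *: (br (X 0) (Y 0) + U 0) = 0).
  by rewrite X0 br0l U0 addr0 scaler0.
- move=> X Y _ _; have e : lbr br Y X = - lbr br X Y.
    by apply/funext => t; exact: brC.
  exact: (half_alt (invlap (lbr br X (lap Y))) (invlap (lbr br Y (lap X))) e).
- move=> X Y Z [lX _] [lY _] [lZ _].
  pose K Y Z t := ip (lap Z t) (br (X t) (Y t)) +
    ip (br (X t) (lap Y t) + br (Y t) (lap X t)) (Z t).
  have cK V W : smooth_loop V -> smooth_loop W -> continuous (K V W).
    move=> lV lW t; apply: cvgD; apply: continuous_ip.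
    - exact: (smooth_loop_lap lW).1.
    - exact: (smooth_lbr lX.1 lV.1).
    - apply: (@smoothD _ _ (lbr br X (lap V)) (lbr br V (lap X))).
        exact: (smooth_lbr lX.1 (smooth_loop_lap lV).1).
      exact: (smooth_lbr lV.1 (smooth_loop_lap lX).1).
    - exact: lW.1.
  have H1K V W : smooth_loop V -> smooth_loop W -> H1 ip (nabla br X V) W =
      2^-1 * \int[lebesgue_measure]_(t in `[0, 2 * pi]) K V W t.
    move=> lV lW.
    have lXV := smooth_loop_lbr lX lV.
    have lC : smooth_loop (lbr br X (lap V) + lbr br V (lap X)).
      apply: smooth_loopD.
        exact: (smooth_loop_lbr lX (smooth_loop_lap lV)).
      exact: (smooth_loop_lbr lV (smooth_loop_lap lX)).
    pose k1 t := ip (lap (lbr br X V) t) (W t).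
    pose k2 t := ip (br (X t) (lap V t) + br (V t) (lap X t)) (W t).
    have c1 : continuous k1.
      exact: (continuous_ip (smooth_loop_lap lXV).1 lW.1).
    have c2 : continuous k2 by exact: (continuous_ip lC.1 lW.1).
    have c3 : continuous (fun t => ip (lap W t) (br (X t) (V t))).
      exact: (continuous_ip (smooth_loop_lap lW).1 lXV.1).
    have -> : H1 ip (nabla br X V) W =
        \int[lebesgue_measure]_(t in `[0, 2 * pi]) (2^-1 * (k1 t + k2 t)).
      apply: eq_Rintegral => t _; rewrite (lapN _ _ lX lV).
      change (ip (2^-1 *: (lap (lbr br X V) t +
        (br (X t) (lap V t) + br (V t) (lap X t)))) (W t) =
        2^-1 * (k1 t + k2 t)).
      by rewrite ipZl ipDl.
    rewrite RintegralZl//; last first.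
      apply: (@continuous_integrable _ (fun t => k1 t + k2 t)) => t.
      by apply: cvgD; [exact: c1|exact: c2].
    rewrite (integralD_cont _ _ c1 c2) (integralD_cont _ _ c3 c2).
    by congr (_ * (_ + _)); exact: (H1_sym lXV lW).
  rewrite (H1_sym lY (lN _ _ lX lZ)) (H1K _ _ lY lZ) (H1K _ _ lZ lY) -mulrDr.
  rewrite -(integralD_cont _ _ (cK _ _ lY lZ) (cK _ _ lZ lY)).
  rewrite (_ : (fun t => K Y Z t + K Z Y t) = cst 0); last first.
    by apply/funext => t; exact: koszul.
  by rewrite Rintegral_cst// mul0r mulr0.
Qed.


End LeviCivita.

End H1Connection.

(* Main.v *)
Require Import Defs.
From mathcomp Require Import all_boot all_order all_algebra.
From mathcomp Require Import all_classical all_reals all_analysis.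
From mathcomp Require Import ring.

Set Implicit Arguments.
Unset Strict Implicit.
Unset Printing Implicit Defensive.

Import Order.TTheory GRing.Theory Num.Theory.
Import numFieldNormedType.Exports.
Import H1Connection.

(** The connection is flat up to constants. For a based loop X and a smooth
    loop Z, the loop nabla_X Z is based and

      (nabla_X Z)' = [X, Z'] + c    for a constant vector c = c_X(Z),

    because (Delta^-1 ([X, Delta Z] + [Z, Delta X]))' differs from
    [X, Z'] - [X', Z] by a constant ([deriv_nabla]). So, after conjugation with
    d/dtheta and modulo constants, nabla_X is the pointwise operator ad X.
    By the Jacobi identity these operators represent the Lie algebra of loops,
    and in the curvature only the effect of the constants survives:

      (Omega(X, Y) Z)' = [X, c_Y(Z)] - [Y, c_X(Z)] + constant.

    A based loop is determined by its derivative modulo constants. If P and Q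
    are the based loops whose derivatives are X and Y minus their means, then

      Omega(X, Y) Z = [P, c_Y(Z)] - [Q, c_X(Z)]                ([curvatureE]).

    Integrating (nabla_X Z - [X, Z])' = c_X(Z) - [X', Z] over the circle gives
    2 pi c_X(Z) = int [X', Z] ([primitive_nabla]). Hence Omega(X, Y) has finite
    rank, and its kernel

      K(s, t) = (2 pi)^-1 (ad P(s) ad Y'(t) - ad Q(s) ad X'(t))

    is a finite sum of products of a smooth loop in s and a smooth loop in t,
    which is smooth ([Ck_tensor]). *)

Local Open Scope classical_set_scope.
Local Open Scope ring_scope.

(** * Brackets and adjoint matrices *)

Section Bracket.
Context {R : realType} {n : nat}.
Context (br : 'rV[R]_n -> 'rV[R]_n -> 'rV[R]_n) (hbr : lie_bracket br).

Lemma lie_addl x y z : br (x + y) z = br x z + br y z.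
Proof. by rewrite -[x]scale1r (lie_linearl hbr) !scale1r. Qed.

Lemma lie_addr x y z : br z (x + y) = br z x + br z y.
Proof. by rewrite -[x]scale1r (lie_linearr hbr) !scale1r. Qed.

Lemma lie_0l x : br 0 x = 0.
Proof. by apply: (@addIr _ (br 0 x)); rewrite -lie_addl !add0r. Qed.

Lemma lie_0r x : br x 0 = 0.
Proof. by apply: (@addIr _ (br x 0)); rewrite -lie_addr !add0r. Qed.

Lemma lie_oppl x y : br (- x) y = - br x y.
Proof. by apply/eqP; rewrite -addr_eq0 -lie_addl addNr lie_0l. Qed.

Lemma lie_oppr x y : br x (- y) = - br x y.
Proof. by apply/eqP; rewrite -addr_eq0 -lie_addr addNr lie_0r. Qed.

Lemma lie_anti x y : br x y = - br y x.
Proof.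
apply/eqP; rewrite -addr_eq0; apply/eqP.
by have := lie_alt hbr (x + y); rewrite lie_addl !lie_addr !(lie_alt hbr) add0r addr0.
Qed.

(** The Jacobi identity in the form ad [x, y] = [ad x, ad y], which is what
    makes the pointwise part of the curvature cancel. *)
Lemma lie_derivation x y z : br (br x y) z = br x (br y z) - br y (br x z).
Proof.
have := lie_jacobi hbr x y z.
rewrite (lie_anti z (br x y)) (lie_anti z x) lie_oppr => /eqP.
by rewrite subr_eq0 => /eqP ->.
Qed.

Lemma lie_scaler (a : R) x y : br x (a *: y) = a *: br x y.
Proof. by rewrite -[a *: y]addr0 (lie_linearr hbr) lie_0r addr0. Qed.

Lemma lie_scalel (a : R) x y : br (a *: x) y = a *: br x y.
Proof. by rewrite -[a *: x]addr0 (lie_linearl hbr) lie_0l addr0. Qed.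

Definition ad_basis (a : 'I_n) : 'M[R]_n :=
  \matrix_(i, j) br (delta_mx 0 a) (delta_mx 0 i) 0 j.

Definition ad_mx (x : 'rV[R]_n) : 'M[R]_n := \sum_a x 0 a *: ad_basis a.

(** The matrix stands on the right because kernels act on row vectors; a
    composite ad x \o ad y therefore becomes ad_mx y *m ad_mx x. *)
Lemma mul_ad_mx x y : y *m ad_mx x = br x y.
Proof.
apply/rowP => j.
rewrite (@bilE _ _ (fun u v => br u v 0 j)); first 1 last.
- by move=> z a u v; rewrite (lie_linearl hbr) !mxE.
- by move=> z a u v; rewrite (lie_linearr hbr) !mxE.
rewrite mulmx_sumr summxE; apply: eq_bigr => a _.
rewrite -scalemxAr mxE mxE big_distrr/=; apply: eq_bigr => i _.
by rewrite mxE mulrA.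
Qed.

End Bracket.

(** * Smoothness of separated kernels *)

Section Kernels.
Context {R : realType}.

(** Reduces a partial derivative to a derivative in one real variable. *)
Lemma is_derive_line (V W : normedModType R) (F : V -> W) (p v : V) l :
  is_derive (0 : R) 1 (fun h : R => F (h *: v + p)) l -> is_derive p v F l.
Proof.
have e : (fun h : R => h^-1 *: (((fun k : R => F (k *: v + p)) \o shift 0) (h *: 1)
            - F (0 *: v + p))) =
         (fun h : R => h^-1 *: ((F \o shift p) (h *: v) - F p)).
  apply/funext => h /=; rewrite scale0r add0r addr0.
  by rewrite (_ : h *: (1 : R) = h)//; exact: mulr1.
by case; rewrite /derivable /derive e => dF <-; split.
Qed.

Lemma is_derive_scalel (V W : normedModType R) (f : V -> R) (p v : V) l (w : W) :
  is_derive p v f l -> is_derive p v (fun x => f x *: w) (l *: w).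
Proof.
move=> [df <-].
have c : h^-1 *: (((fun x => f x *: w) \o shift p) (h *: v) - f p *: w)
     @[h --> 0^'] --> 'D_v f p *: w.
  under eq_fun do rewrite /= -scalerBl scalerA.
  exact: cvgZr_tmp.
split; first by apply/cvg_ex; eexists; exact: c.
exact: cvg_lim c.
Qed.

Lemma Ck_ext (V : normedModType R) k (F G : R * R -> V) : F = G -> Ck k F -> Ck k G.
Proof. by move=> ->. Qed.

Lemma CkD (V : normedModType R) k (F G : R * R -> V) :
  Ck k F -> Ck k G -> Ck k (F + G).
Proof.
elim: k F G => [|k IH] F G [cF dF] [cG dG]; split.
- by move=> p; apply: cvgD; [exact: cF|exact: cG].
- by [].
- by move=> p; apply: cvgD; [exact: cF|exact: cG].
case: dF => dF F1 F2; case: dG => dG G1 G2; split.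
- by move=> p; case: (dF p) (dG p) => ? ? [? ?]; split; exact: derivableD.
- apply: Ck_ext (IH _ _ F1 G1); apply/funext => p.
  by rewrite deriveD//; [have [] := dF p|have [] := dG p].
- apply: Ck_ext (IH _ _ F2 G2); apply/funext => p.
  by rewrite deriveD//; [have [] := dF p|have [] := dG p].
Qed.

Lemma Ck0 (V : normedModType R) k : Ck k (0 : R * R -> V).
Proof.
elim: k => [|k IH] /=; split; try exact: cst_continuous; first by [].
have e v : 'D_v (0 : R * R -> V) = 0 by apply/funext => p; exact: derive_cst.
by rewrite !e; split=> // p; split; exact: derivable_cst.
Qed.

Lemma Ck_sum (V : normedModType R) k (I : Type) (r : seq I) (F : I -> R * R -> V) :
  (forall i, Ck k (F i)) -> Ck k (\sum_(i <- r) F i).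
Proof. by move=> h; elim/big_rec: _ => [|i G _ hG]; [exact: Ck0|exact: CkD]. Qed.

Local Notation smooth f := (forall k (t : R), derivable (derive1n k f) t (1 : R)).

(** The two partial derivatives of f_a(s) g_b(t) w replace f by f' or g by g',
    hence have the same form: induct on k for all f and g at once. *)
Lemma Ck_tensor (V : normedModType R) m n k (f : R -> 'rV[R]_m) (g : R -> 'rV[R]_n)
    (a : 'I_m) (b : 'I_n) (w : V) : smooth f -> smooth g ->
  Ck k (fun p => (f p.1 0 a * g p.2 0 b) *: w).
Proof.
have cF (u : R -> 'rV[R]_m) (v : R -> 'rV[R]_n) : smooth u -> smooth v ->
    continuous (fun p : R * R => (u p.1 0 a * v p.2 0 b) *: w).
  move=> su sv p; apply: cvgZr_tmp; apply: cvgM.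
    apply: (@continuous_comp _ _ _ fst (fun s => u s 0 a)); first exact: cvg_fst.
    apply: (@continuous_comp _ _ _ u (fun x : 'rV[R]_m => x 0 a)).
      exact: smooth_continuous.
    exact: coord_continuous.
  apply: (@continuous_comp _ _ _ snd (fun s => v s 0 b)); first exact: cvg_snd.
  apply: (@continuous_comp _ _ _ v (fun x : 'rV[R]_n => x 0 b)).
    exact: smooth_continuous.
  exact: coord_continuous.
elim: k f g => [|k IH] f g sf sg; first by split=> //; exact: cF.
have /smoothS[df hf sdf] := sf; have /smoothS[dg hg sdg] := sg.
pose F p : V := (f p.1 0 a * g p.2 0 b) *: w.
have D1 p : is_derive p ((1, 0) : R * R) F ((df p.1 0 a * g p.2 0 b) *: w).
  apply: is_derive_scalel; apply: is_derive_line.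
  have -> : (fun h : R => f (h *: ((1, 0) : R * R) + p).1 0 a *
      g (h *: ((1, 0) : R * R) + p).2 0 b) =
      g p.2 0 b \*: (fun h : R => f (h + p.1) 0 a).
    apply/funext => h /=; rewrite mulrC; congr (g _ 0 b * f _ 0 a).
      by rewrite (_ : h *: (0 : R) = 0) ?add0r//; exact: mulr0.
    by congr (_ + _); exact: mulr1.
  have := (is_derive_rV _ _ _).1 (deriv_shift p.1 hf (0 : R)) a.
  by rewrite add0r mulrC => ?; exact: is_deriveZ.
have D2 p : is_derive p ((0, 1) : R * R) F ((f p.1 0 a * dg p.2 0 b) *: w).
  apply: is_derive_scalel; apply: is_derive_line.
  have -> : (fun h : R => f (h *: ((0, 1) : R * R) + p).1 0 a *
      g (h *: ((0, 1) : R * R) + p).2 0 b) =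
      f p.1 0 a \*: (fun h : R => g (h + p.2) 0 b).
    apply/funext => h /=; congr (f _ 0 a * g _ 0 b).
      by rewrite (_ : h *: (0 : R) = 0) ?add0r//; exact: mulr0.
    by congr (_ + _); exact: mulr1.
  have := (is_derive_rV _ _ _).1 (deriv_shift p.2 hg (0 : R)) b.
  by rewrite add0r => ?; exact: is_deriveZ.
split; first exact: cF.
split.
- by move=> p; have := D1 p; have := D2 p => ? ?; split; exact: ex_derive.
- apply: Ck_ext (IH df g sdf sg); apply/funext => p.
  by apply/esym; apply: derive_val.
- apply: Ck_ext (IH f dg sf sdg); apply/funext => p.
  by apply/esym; apply: derive_val.
Qed.

Lemma Ck_ad_mx n (br : 'rV[R]_n -> 'rV[R]_n -> 'rV[R]_n) k (P dY : R -> 'rV[R]_n) :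
  smooth P -> smooth dY ->
  Ck k (fun p => ad_mx br (dY p.2) *m ad_mx br (P p.1)).
Proof.
move=> sP sY.
apply: Ck_ext; last first.
  apply: (@Ck_sum _ k _ (index_enum 'I_n) (fun a => \sum_b (fun p =>
    (P p.1 0 a * dY p.2 0 b) *: (ad_basis br b *m ad_basis br a)))) => a.
  by apply: Ck_sum => b; exact: Ck_tensor.
apply/funext => p; rewrite fct_sumE [in RHS]/ad_mx mulmx_sumr.
apply: eq_bigr => a _; rewrite fct_sumE mulmx_suml; apply: eq_bigr => b _.
by rewrite -scalemxAl -scalemxAr scalerA mulrC.
Qed.

End Kernels.

(** * The connection modulo constants *)

Section Curvature.
Context {R : realType} {n : nat}.
Notation g := 'rV[R]_n.
Context (br : g -> g -> g) (hbr : lie_bracket br).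
Local Notation smooth f := (forall k (t : R), derivable (derive1n k f) t (1 : R)).
Implicit Types (X Y Z P Q G f : R -> g) (c : g).

Lemma deriv_cst c : deriv (fun=> c : g) (0 : R -> g).
Proof. by move=> t; exact: is_derive_cst. Qed.

Lemma loop_2pi X : smooth_loop X -> X (2 * pi) = X 0.
Proof. by move=> [_ pX]; rewrite -(pX 0) add0r. Qed.

(** A based loop is determined by its derivative modulo constants: an affine
    function that vanishes at both ends of [0, 2 pi] is zero. *)
Lemma deriv_cst_eq0 f c : deriv f (fun=> c) -> f 0 = 0 -> f (2 * pi) = 0 ->
  f = 0.
Proof.
move=> hf f0 f1.
have /deriv0_cst h : deriv (f - (fun t => t *: c)) 0.
  by rewrite -(subrr (fun=> c)); apply: derivB => //; exact: deriv_lin.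
have ft t : f t = t *: c.
  have e : f t - t *: c = f 0 - 0 *: c := h t 0.
  by apply/eqP; rewrite -subr_eq0 e f0 scale0r subr0.
have c0 : c = 0.
  have /esym/eqP := f1; rewrite ft eq_sym scaler_eq0 gt_eqF ?twopi_gt0//=.
  by move=> /eqP.
by apply/funext => t; rewrite ft c0 scaler0.
Qed.

(** A primitive of X is periodic only after subtracting from X its mean c. *)
Lemma loop_primitive X : smooth_loop X ->
  exists P c, [/\ smooth_loop P, P 0 = 0 & deriv P (X - (fun=> c))].
Proof.
move=> [sX pX]; have [F F0 hF] := antideriv (smooth_continuous sX).
pose c := (2 * pi)^-1 *: F (2 * pi); pose P := F - (fun t => t *: c).
have hP : deriv P (X - (fun=> c)) by apply: derivB => //; exact: deriv_lin.
have P0 : P 0 = 0 by change (F 0 - 0 *: c = 0); rewrite F0 scale0r subr0.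
have P1 : P (0 + 2 * pi) = 0.
  change (F (0 + 2 * pi) - (0 + 2 * pi) *: c = 0).
  by rewrite add0r scalerA divff ?scale1r ?subrr// gt_eqF// twopi_gt0.
have sP : smooth P.
  have [dX hX sdX] := (smoothS X).1 sX.
  apply: (smoothS P).2; exists (X - (fun=> c)); first exact: hP.
  apply: (smoothS _).2; exists dX; last exact: sdX.
  by rewrite -[dX]subr0; apply: derivB; [exact: hX|exact: deriv_cst].
suff pP : forall t, P (t + 2 * pi) = P t by exists P, c; split; [split|exact: P0|exact: hP].
have /deriv0_cst h : deriv ((fun t => P (t + 2 * pi)) - P) 0.
  have -> : 0 = (fun t => (X - (fun=> c)) (t + 2 * pi)) - (X - (fun=> c)).
    apply/funext => t.
    change (0 = X (t + 2 * pi) - c - (X t - c)).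
    by rewrite pX subrr.
  by apply: derivB; [exact: deriv_shift|exact: hP].
move=> t; apply/eqP; rewrite -subr_eq0; apply/eqP.
have e : P (t + 2 * pi) - P t = P (0 + 2 * pi) - P 0 := h t 0.
by rewrite e P1 P0 subrr.
Qed.

Lemma nabla_based X Z : based_loop X -> smooth_loop Z -> based_loop (nabla br X Z).
Proof.
move=> [lX X0] lZ; have [U [lU U0 _ ->]] := nablaE hbr lX lZ; split.
  exact/smooth_loopZ/smooth_loopD/lU/smooth_loop_lbr.
change (2^-1 *: (br (X 0) (Z 0) + U 0) = 0).
by rewrite X0 (lie_0l hbr) U0 addr0 scaler0.
Qed.

(** With nabla_X Z = ([X, Z] + U) / 2, the equation for U reads
    U'' = [X, Z''] - [X'', Z] = ([X, Z'] - [X', Z])', so U' is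
    [X, Z'] - [X', Z] up to a constant, and the terms [X', Z] cancel in the sum
    [X, Z]' + U'. *)
Lemma deriv_nabla X Z dZ : smooth_loop X -> smooth_loop Z -> deriv Z dZ ->
  exists c, deriv (nabla br X Z) (lbr br X dZ + (fun=> c)).
Proof.
move=> lX lZ hZ; have [U [lU _ lapU ->]] := nablaE hbr lX lZ.
have [X1 [X2 [hX1 hX2 _ _ lapX]]] := smooth_loop_deriv2 lX.
have [Z1 [Z2 [hZ1 hZ2 _ _ lapZ]]] := smooth_loop_deriv2 lZ.
have [U1 [U2 [hU1 hU2 _ _ lapU']]] := smooth_loop_deriv2 lU.
have eZ : dZ = Z1 by rewrite -(derivE hZ) (derivE hZ1).
pose c := U1 0 - (br (X 0) (Z1 0) - br (X1 0) (Z 0)).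
have hV := derivB (deriv_lbr hbr hX1 hZ2) (deriv_lbr hbr hX2 hZ1).
have /deriv0_cst h : deriv (U1 - (lbr br X Z1 - lbr br X1 Z)) 0.
  suff -> : 0 = U2 - (lbr br X1 Z1 + lbr br X Z2 - (lbr br X2 Z + lbr br X1 Z1)).
    exact: derivB.
  rewrite -[U2]opprK -lapU' lapU lapX lapZ; apply/funext => t.
  change (0 = - (br (X t) (- Z2 t) + br (Z t) (- X2 t)) -
    (br (X1 t) (Z1 t) + br (X t) (Z2 t) - (br (X2 t) (Z t) + br (X1 t) (Z1 t)))).
  rewrite !(lie_oppr hbr) (lie_anti hbr (Z t)).
  move: (br (X t) _) (br (X1 t) _) (br (X2 t) _) => u v w.
  by apply/rowP => i; rewrite !mxE; ring.
have {}h t : U1 t = br (X t) (Z1 t) - br (X1 t) (Z t) + c.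
  by apply/eqP; rewrite addrC -subr_eq; apply/eqP; exact: h.
exists (2^-1 *: c); rewrite eZ.
suff -> : lbr br X Z1 + (fun=> 2^-1 *: c) =
    2^-1 *: (lbr br X1 Z + lbr br X Z1 + U1).
  by apply: derivZ; apply: derivD => //; exact: deriv_lbr.
apply/funext => t.
change (br (X t) (Z1 t) + 2^-1 *: c =
  2^-1 *: (br (X1 t) (Z t) + br (X t) (Z1 t) + U1 t)).
by rewrite h; apply/rowP => i; rewrite !mxE; field.
Qed.

(** Identifies the constant: 2 pi c is the integral of [X', Z] over the circle,
    here the increment of a primitive G. The primitive is
    t c - (nabla_X Z - [X, Z]), whose second term is periodic. *)
Lemma primitive_nabla X dX Z dZ c : based_loop X -> smooth_loop Z ->
  deriv X dX -> deriv Z dZ -> deriv (nabla br X Z) (lbr br X dZ + (fun=> c)) ->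
  exists2 G, deriv G (lbr br dX Z) & G (2 * pi) - G 0 = (2 * pi) *: c.
Proof.
move=> bX lZ hX hZ hW; have [lX X0] := bX.
have [lW W0] := nabla_based bX lZ.
exists ((fun t => t *: c) - (nabla br X Z - lbr br X Z)).
  have -> : lbr br dX Z = (fun=> c) -
      (lbr br X dZ + (fun=> c) - (lbr br dX Z + lbr br X dZ)).
    apply/funext => t.
    change (br (dX t) (Z t) = c - (br (X t) (dZ t) + c -
      (br (dX t) (Z t) + br (X t) (dZ t)))).
    by apply/rowP => i; rewrite !mxE; ring.
  apply: derivB; first exact: deriv_lin.
  by apply: derivB => //; exact: deriv_lbr.
change (2 * pi *: c - (nabla br X Z (2 * pi) - br (X (2 * pi)) (Z (2 * pi))) -
  (0 *: c - (nabla br X Z 0 - br (X 0) (Z 0))) = 2 * pi *: c).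
by rewrite !loop_2pi// scale0r sub0r opprK subrK.
Qed.

(** Both sides are based loops, so it is enough to compare derivatives modulo
    constants. Those of nabla_X nabla_Y Z, nabla_Y nabla_X Z and nabla_[X, Y] Z
    are [X, [Y, Z'] + cY], [Y, [X, Z'] + cX] and [[X, Y], Z']; the double
    brackets cancel by the Jacobi identity and [X, cY] - [Y, cX] remains. *)
Lemma curvatureE X Y Z dZ P Q cX cY mX mY :
  based_loop X -> based_loop Y -> smooth_loop Z -> deriv Z dZ ->
  deriv (nabla br X Z) (lbr br X dZ + (fun=> cX)) ->
  deriv (nabla br Y Z) (lbr br Y dZ + (fun=> cY)) ->
  smooth_loop P -> P 0 = 0 -> deriv P (X - (fun=> mX)) ->
  smooth_loop Q -> Q 0 = 0 -> deriv Q (Y - (fun=> mY)) ->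
  curvature br X Y Z = (fun s => br (P s) cY - br (Q s) cX).
Proof.
move=> bX bY lZ hZ hXZ hYZ lP P0 hP lQ Q0 hQ.
have lXY : smooth_loop (lbr br X Y) := smooth_loop_lbr hbr bX.1 bY.1.
have bXY : based_loop (lbr br X Y) by split=> //; rewrite /lbr bX.2 (lie_0l hbr).
have bXZ := nabla_based bX lZ; have bYZ := nabla_based bY lZ.
have bXYZ := nabla_based bX bYZ.1; have bYXZ := nabla_based bY bXZ.1.
have bC := nabla_based bXY lZ.
have [a ha] := deriv_nabla bX.1 bYZ.1 hYZ.
have [b hb] := deriv_nabla bY.1 bXZ.1 hXZ.
have [c hc] := deriv_nabla lXY lZ hZ.
apply/eqP; rewrite -subr_eq0; apply/eqP.
have hPc := deriv_lbr hbr hP (deriv_cst cY).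
have hQc := deriv_lbr hbr hQ (deriv_cst cX).
have h := derivB (derivB (derivB ha hb) hc) (derivB hPc hQc).
apply: (@deriv_cst_eq0 _ (a - b - c + br mX cY - br mY cX)); last 2 first.
- change (nabla br X (nabla br Y Z) 0 - nabla br Y (nabla br X Z) 0 -
    nabla br (lbr br X Y) Z 0 - (br (P 0) cY - br (Q 0) cX) = 0).
  by rewrite bXYZ.2 bYXZ.2 bC.2 P0 Q0 !(lie_0l hbr) !subr0.
- change (nabla br X (nabla br Y Z) (2 * pi) - nabla br Y (nabla br X Z) (2 * pi) -
    nabla br (lbr br X Y) Z (2 * pi) - (br (P (2 * pi)) cY - br (Q (2 * pi)) cX) = 0).
  rewrite !loop_2pi ?bXYZ.2 ?bYXZ.2 ?bC.2 ?P0 ?Q0 ?(lie_0l hbr) ?subr0//.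
  + exact: bC.1.
  + exact: bYXZ.1.
  + exact: bXYZ.1.
move: h; congr (deriv _ _); apply/funext => t.
change (br (X t) (br (Y t) (dZ t) + cY) + a - (br (Y t) (br (X t) (dZ t) + cX) + b)
  - (br (br (X t) (Y t)) (dZ t) + c)
  - (br (X t - mX) cY + br (P t) 0 - (br (Y t - mY) cX + br (Q t) 0))
  = a - b - c + br mX cY - br mY cX).
rewrite !(lie_0r hbr) !addr0 !(lie_addl hbr) !(lie_addr hbr) !(lie_oppl hbr).
rewrite (lie_derivation hbr).
move: (br (X t) (br _ _)) (br (Y t) (br _ _)) => u v.
move: (br (X t) cY) (br (Y t) cX) (br mX _) (br mY _) => x y p q.
apply/rowP => i; rewrite !mxE; ring.
Qed.

End Curvature.

(** * The curvature is smoothing *)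

Theorem proposition3p1 (R : realType) (n : nat)
  (br : 'rV[R]_n -> 'rV[R]_n -> 'rV[R]_n) (ip : 'rV[R]_n -> 'rV[R]_n -> R)
  (hbr : lie_bracket br) (hip : inner_product ip) (hinv : ad_invariant br ip)
  (X Y : R -> 'rV[R]_n) (hX : based_loop X) (hY : based_loop Y) :
  smoothing (curvature br X Y).
Proof.
have [dX hdX ldX] := smooth_loop_deriv hX.1.
have [dY hdY ldY] := smooth_loop_deriv hY.1.
have [P [mX [lP P0 hP]]] := loop_primitive hX.1.
have [Q [mY [lQ Q0 hQ]]] := loop_primitive hY.1.
pose k := (2 * pi : R)^-1.
have lkP := smooth_loopZ k lP; have lkQ := smooth_loopZ (- k) lQ.
pose K (p : R * R) := ad_mx br (dY p.2) *m ad_mx br ((k *: P) p.1) +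
  ad_mx br (dX p.2) *m ad_mx br ((- k *: Q) p.1).
exists K; split.
  split.
    move=> j; apply: (@CkD _ _ j (fun p => ad_mx br (dY p.2) *m ad_mx br ((k *: P) p.1))).
      exact: Ck_ad_mx lkP.1 ldY.1.
    exact: Ck_ad_mx lkQ.1 ldX.1.
  by move=> s t; rewrite /K/= lkP.2 lkQ.2 ldX.2 ldY.2.
move=> Z lZ s; have [dZ hdZ ldZ] := smooth_loop_deriv lZ.
have [cX hcX] := deriv_nabla hbr hX.1 lZ hdZ.
have [cY hcY] := deriv_nabla hbr hY.1 lZ hdZ.
have [GX hGX eGX] := primitive_nabla hbr hX lZ hdX hdZ hcX.
have [GY hGY eGY] := primitive_nabla hbr hY lZ hdY hdZ hcY.
rewrite (curvatureE hbr hX hY lZ hdZ hcX hcY lP P0 hP lQ Q0 hQ).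
(* A primitive in t of Z t *m K (s, t): the increments of GY and GX over
   [0, 2 pi] are 2 pi cY and 2 pi cX, so the factor k normalises them. *)
pose q := lbr br (fun=> (k *: P) s) GY + lbr br (fun=> (- k *: Q) s) GX.
pose q' t := br ((k *: P) s) (br (dY t) (Z t)) + br ((- k *: Q) s) (br (dX t) (Z t)).
have hq : deriv q q'.
  have := derivD (deriv_lbr hbr (deriv_cst ((k *: P) s)) hGY)
    (deriv_lbr hbr (deriv_cst ((- k *: Q) s)) hGX).
  congr (deriv _ _); apply/funext => t.
  change (br 0 (GY t) + br ((k *: P) s) (br (dY t) (Z t)) +
    (br 0 (GX t) + br ((- k *: Q) s) (br (dX t) (Z t))) = q' t).
  by rewrite !(lie_0l hbr) !add0r.
have cq' : continuous q'.
  have [A hA _] := smooth_loop_deriv (smooth_loop_lbr hbr ldY lZ).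
  have [B hB _] := smooth_loop_deriv (smooth_loop_lbr hbr ldX lZ).
  exact: deriv_continuous (derivD (deriv_lbr hbr (deriv_cst ((k *: P) s)) hA)
    (deriv_lbr hbr (deriv_cst ((- k *: Q) s)) hB)).
apply/rowP => i; rewrite [RHS]mxE.
under eq_Rintegral do rewrite mulmxDr !mulmxA !(mul_ad_mx hbr).
have -> : \int[lebesgue_measure]_(t in `[0, 2 * pi]) q' t 0 i =
    q (2 * pi) 0 i - q 0 0 i.
  apply: (@integral_derivative _ _ _ (fun t => q t 0 i)).
  - exact: twopi_gt0.
  - by move=> t; exact: ((is_derive_rV _ _ _).1 (hq t) i).
  - move=> t; apply: (@continuous_comp _ _ _ q' (fun x : 'rV[R]_n => x 0 i)).
      exact: cq'.
    exact: coord_continuous.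
suff -> : br (P s) cY - br (Q s) cX = q (2 * pi) - q 0 by rewrite !mxE.
change (br (P s) cY - br (Q s) cX =
  br (k *: P s) (GY (2 * pi)) + br (- k *: Q s) (GX (2 * pi)) -
  (br (k *: P s) (GY 0) + br (- k *: Q s) (GX 0))).
rewrite opprD addrACA -!(lie_oppr hbr) -!(lie_addr hbr) eGX eGY.
rewrite !(lie_scaler hbr) !(lie_scalel hbr) scaleNr scalerN !scalerA.
by rewrite (lie_oppr hbr) mulfV ?scale1r// gt_eqF// twopi_gt0.
Qed.
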